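(* Let $\epsilon\in\{0,\frac12\}$, $b_1,b_2\in\mathbb{C}$, and let $M_1,M_2$ be irreducible $\mathcal{D}$-modules. Then $H_{\epsilon,b_1}(M_1)\cong H_{\epsilon,b_2}(M_2)$ as $\mathfrak{g}[\epsilon]$-modules if and only if one of the following holds: (i) $b_1=b_2$ and $M_1\cong M_2$ as $\mathcal{D}$-modules; (ii) $(b_1,b_2)=(\frac12,0)$, $M_1\cong M_2$ as $\mathcal{D}$-modules, and $M_1=D(M_1)$; (iii) $(b_1,b_2)=(0,\frac12)$, $M_1\cong M_2$ as $\mathcal{D}$-modules, and $M_2=D(M_2)$.
   Context: All vector spaces, algebras and modules are over $\mathbb{C}$; modules over Lie superalgebras are $\mathbb{Z}_2$-graded. An isomorphism of $\mathfrak{g}[\epsilon]$-modules here means a linear bijection commuting with the action of $\mathfrak{g}[\epsilon]$ that is homogeneous for the $\mathbb{Z}_2$-grading, either even (parity preserving) or odd (parity reversing). Super-Virasoro algebra (centerless): for $\epsilon\in\{0,\frac12\}$, $\mathfrak{g}[\epsilon]$ is the Lie superalgebra with even basis $\{L_n\mid n\in\mathbb{Z}\}$, odd basis $\{G_p\mid p\in\mathbb{Z}+\epsilon\}$, and brackets $[L_m,L_n]=(m-n)L_{m+n}$, $[G_p,G_q]=2L_{p+q}$, $[L_m,G_p]=(\frac m2-p)G_{m+p}$. Weyl algebra: $\mathcal{D}$ is the associative algebra generated by $t^{\pm1}$ and $\partial_t=\frac{d}{dt}$ subject to $\partial_t t-t\partial_t=1$; put $D=t\frac{d}{dt}$. $D(M)=\{Dv\mid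 v\in M\}$. For a $\mathcal{D}$-module $M$ let $\overline{M}=\{\overline v\mid v\in M\}$ be a copy of $M$. On $M\oplus\overline{M}$ (with $M$ even and $\overline{M}$ odd) let $x\in\mathcal{D}$ act on $M$ as given and on $\overline{M}$ by $x\cdot\overline v=\overline{xv}$, and let $\theta\cdot v=\overline v$, $\theta\cdot\overline v=0$, $\partial_\theta\cdot v=0$, $\partial_\theta\cdot\overline v=v$ for $v\in M$. For $b\in\mathbb{C}$, $H_{\epsilon,b}(M)$ is the $\mathfrak{g}[\epsilon]$-module $M\oplus\overline{M}$ with action $$L_m\cdot v=-t^{m}\left(D+(m-2\epsilon)b+\tfrac{m+2\epsilon}{2}\theta\partial_\theta\right)v,\quad G_p\cdot v=t^{p-\epsilon}\left(\theta D+2(p-\epsilon)b\,\theta-t^{2\epsilon}\partial_\theta\right)v$$ for $m\in\mathbb{Z}$, $p\in\mathbb{Z}+\epsilon$, $v\in M\oplus\overline{M}$. *)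

(* Defs.v *)
From HB Require Import structures.
From mathcomp Require Import all_boot all_order all_algebra.
From mathcomp Require Import classical_sets reals complex.
From mathcomp Require Import ring.

Set Implicit Arguments.
Unset Strict Implicit.
Unset Printing Implicit Defensive.

Import Order.TTheory GRing.Theory Num.Theory.
Local Open Scope ring_scope.

(* Modules over the Weyl algebra K<t, t^-1, d | t t^-1 = t^-1 t = 1,
   d t - t d = 1>: by the universal property of this presentation, they are
   the vector spaces with operators satisfying the relations. *)
Record dmodule (K : numFieldType) := DModule {
  dcar :> lmodType K;
  dt : {linear dcar -> dcar};
  dtV : {linear dcar -> dcar};
  dd : {linear dcar -> dcar};
  dtK : cancel dt dtV;
  dtVK : cancel dtV dt;
  dweyl : forall v, dd (dt v) - dt (dd v) = v }.

Arguments dt {K M} : rename.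
Arguments dtV {K M} : rename.
Arguments dd {K M} : rename.

(* [tpow n] is the action of t^n, n an arbitrary integer. *)
Definition tpow (K : numFieldType) (M : dmodule K) (n : int) (v : M) : M :=
  match n with
  | Posz k => iter k dt v
  | Negz k => iter k.+1 dtV v
  end.

Definition euler (K : numFieldType) (M : dmodule K) (v : M) : M := dt (dd v).

Definition dmod_submodule (K : numFieldType) (M : dmodule K) (S : set M) : Prop :=
  [/\ S 0,
      forall (a : K) (u v : M), S u -> S v -> S (a *: u + v)
    & forall v, S v -> [/\ S (dt v), S (dtV v) & S (dd v)]].

Definition dmod_irreducible (K : numFieldType) (M : dmodule K) : Prop :=
  (exists v : M, v <> 0) /\
  forall S : set M, dmod_submodule S -> S = [set 0]%classic \/ S = [set: M]%classic.

Definition dmod_iso (K : numFieldType) (M N : dmodule K) : Prop :=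
  exists f : {linear M -> N}, bijective f /\
    forall v, [/\ f (dt v) = dt (f v), f (dtV v) = dtV (f v)
                & f (dd v) = dd (f v)].

(* The sector fixes the parameter: epsilon = 0 (Ramond) or epsilon = 1/2
   (Neveu-Schwarz).  [eps2] is the integer 2 epsilon. *)
Inductive sector := Ramond | NeveuSchwarz.

Definition eps2 (s : sector) : int :=
  match s with Ramond => 0 | NeveuSchwarz => 1 end.

Definition eps (K : numFieldType) (s : sector) : K := (eps2 s)%:~R / 2.
Arguments eps K s : clear implicits.

(* A Z_2-graded vector space is a product V0 * V1, with even part the elements
   (x, 0) and odd part the elements (0, y). *)
Definition is_even (K : numFieldType) (V0 V1 : lmodType K) (v : V0 * V1) : Prop :=
  v.2 = 0.

Definition is_odd (K : numFieldType) (V0 V1 : lmodType K) (v : V0 * V1) : Prop :=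
  v.1 = 0.

(* Modules over the centerless super-Virasoro algebra g[epsilon], given by the
   action of the basis L_m, G_p.  The odd basis, indexed by p in Z + epsilon, is
   reindexed by the integers: [svG k] is the action of G_(k + epsilon), so that
   G_p, G_q with p = k + epsilon, q = l + epsilon have p + q = k + l + 2 epsilon. *)
Record svir_module (K : numFieldType) (s : sector) := SvirModule {
  sv0 : lmodType K;
  sv1 : lmodType K;
  svL : int -> {linear (sv0 * sv1)%type -> (sv0 * sv1)%type};
  svG : int -> {linear (sv0 * sv1)%type -> (sv0 * sv1)%type};
  svL_even : forall m v, is_even v -> is_even (svL m v);
  svL_odd : forall m v, is_odd v -> is_odd (svL m v);
  svG_even : forall k v, is_even v -> is_odd (svG k v);
  svG_odd : forall k v, is_odd v -> is_even (svG k v);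
  svLL : forall m n v,
    svL m (svL n v) - svL n (svL m v) = (m - n)%:~R *: svL (m + n) v;
  svGG : forall k l v,
    svG k (svG l v) + svG l (svG k v) = 2 *: svL (k + l + eps2 s) v;
  svLG : forall m k v,
    svL m (svG k v) - svG k (svL m v) =
      (m%:~R / 2 - (k%:~R + eps K s)) *: svG (m + k) v }.

Definition sv_car (K : numFieldType) (s : sector) (V : svir_module K s) : lmodType K :=
  (sv0 V * sv1 V)%type.

Definition svir_iso (K : numFieldType) (s : sector) (V W : svir_module K s) : Prop :=
  exists f : {linear sv_car V -> sv_car W},
    [/\ bijective f,
        forall m v, f (svL V m v) = svL W m (f v),
        forall k v, f (svG V k v) = svG W k (f v)
      & ((forall v, is_even v -> is_even (f v)) /\
         (forall v, is_odd v -> is_odd (f v))) \/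
        ((forall v, is_even v -> is_odd (f v)) /\
         (forall v, is_odd v -> is_even (f v)))].

Section TensorModule.
(* M (+) Mbar is represented by M * M, x in M being (x, 0) and xbar being (0, x). *)
Variables (K : numFieldType) (M : dmodule K).

Definition dact (x : M -> M) (v : M * M) : M * M := (x v.1, x v.2).

Definition theta (v : M * M) : M * M := (0, v.1).

Definition dtheta (v : M * M) : M * M := (v.2, 0).

Variables (s : sector) (b : K).

Definition HL (m : int) (v : M * M) : M * M :=
  - dact (tpow m)
      (dact (@euler K M) v + ((m - eps2 s)%:~R * b) *: v
       + ((m + eps2 s)%:~R / 2) *: theta (dtheta v)).

(* This is the action of G_p for p = k + epsilon, so k = p - epsilon. *)
Definition HG (k : int) (v : M * M) : M * M :=
  dact (tpow k)
    (theta (dact (@euler K M) v) + (2 * k%:~R * b) *: theta v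
     - dact (tpow (eps2 s)) (dtheta v)).

Lemma tpow_linear n : linear (@tpow K M n).
Proof.
case: n => k a u v /=.
  by elim: k => //= k ->; rewrite linearP.
by rewrite -!iterS; elim: k.+1 => //= j ->; rewrite linearP.
Qed.
HB.instance Definition _ n :=
  GRing.isLinear.Build K M M *:%R (@tpow K M n) (tpow_linear n).

Lemma euler_linear : linear (@euler K M).
Proof. by move=> a u v; rewrite /euler !linearP. Qed.
HB.instance Definition _ :=
  GRing.isLinear.Build K M M *:%R (@euler K M) euler_linear.

Lemma tpowS n (v : M) : tpow (n + 1) v = dt (tpow n v).
Proof.
case: n => [k|[|k]].
- by rewrite -PoszD addn1.
- by rewrite /= dtVK.
- by rewrite NegzE -[in LHS]addn1 PoszD opprD addrNK -NegzE /= dtVK.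
Qed.

Lemma tpowP n (v : M) : tpow (n - 1) v = dtV (tpow n v).
Proof. by rewrite -{2}(subrK 1 n) tpowS dtK. Qed.

Lemma tpowD m n (v : M) : tpow m (tpow n v) = tpow (m + n) v.
Proof.
elim/int_ind: m => [|k IH|k IH]; first by rewrite add0r.
- by rewrite -addn1 PoszD tpowS IH -tpowS addrAC.
- by rewrite -addn1 PoszD opprD tpowP IH -tpowP addrAC.
Qed.

Lemma euler_tpow n (v : M) : euler (tpow n v) = tpow n (euler v + n%:~R *: v).
Proof.
have eulerS (u : M) : euler (dt u) = dt (euler u + u).
  by rewrite /euler -{3}(dweyl u) addrC subrK.
have eulerP (u : M) : euler (dtV u) = dtV (euler u - u).
  rewrite -[LHS]dtK; congr (dtV _).
  by have := eulerS (dtV u); rewrite dtVK linearD /= dtVK => ->; rewrite addrK.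
elim/int_ind: n => [|k IH|k IH]; first by rewrite /= scale0r addr0.
- rewrite -addn1 PoszD !tpowS eulerS IH -linearD /= rmorphD /=.
  by rewrite scalerDl scale1r addrA.
- rewrite -addn1 PoszD opprD !tpowP eulerP IH -linearB /= rmorphB /=.
  by rewrite scalerBl scale1r addrA.
Qed.

(* [qop n x y z] is the action of t^n (x D^2 + y D + z). *)
Definition qop (n : int) (x y z : K) (v : M) : M :=
  tpow n (x *: euler (euler v) + y *: euler v + z *: v).

Lemma qopD n x y z x' y' z' v :
  qop n x y z v + qop n x' y' z' v = qop n (x + x') (y + y') (z + z') v.
Proof.
rewrite /qop -linearD /= !scalerDl addrACA.
by congr (tpow _ (_ + _)); rewrite addrACA.
Qed.

Lemma qopZ a n x y z v : a *: qop n x y z v = qop n (a * x) (a * y) (a * z) v.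
Proof. by rewrite /qop -linearZ /= !scalerDr !scalerA. Qed.

Lemma qopN n x y z v : - qop n x y z v = qop n (- x) (- y) (- z) v.
Proof. by rewrite -scaleN1r qopZ !mulN1r. Qed.

Lemma qop_comp m n y z y' z' v :
  qop m 0 y z (qop n 0 y' z' v) =
  qop (m + n) (y * y') (y * z' + (y * n%:~R + z) * y')
    ((y * n%:~R + z) * z') v.
Proof.
rewrite /qop !scale0r !add0r euler_tpow -!linearZ /= -linearD /= tpowD.
congr tpow; rewrite scalerDr -addrA scalerA -scalerDl.
by rewrite linearD /= !linearZ /= !scalerDr !scalerA scalerDl !addrA.
Qed.

Lemma HLE m v :
  let c := (m - eps2 s)%:~R * b in
  HL m v = (qop m 0 (-1) (- c) v.1,
            qop m 0 (-1) (- (c + (m + eps2 s)%:~R / 2)) v.2).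
Proof.
move=> c; case: v => x y; rewrite /HL /dact /theta /dtheta /qop /= -/c.
rewrite !scale0r !add0r !scaleN1r.
have -> (u w : M) : - (u, w) = (- u, - w) by [].
by rewrite scaler0 addr0 -!(linearN (tpow m)) /= !scaleNr scalerDl !opprD addrA.
Qed.

Lemma HGE k v :
  HG k v = (qop (k + eps2 s) 0 0 (-1) v.2, qop k 0 1 (2 * k%:~R * b) v.1).
Proof.
case: v => x y; rewrite /HG /dact /theta /dtheta /qop /=.
rewrite (linear0 (tpow _)) subr0 scaler0 !add0r !scale0r !add0r scale1r.
by rewrite scaleN1r -tpowD !linearN.
Qed.

Lemma qop_linear n x y z : linear (qop n x y z).
Proof.
move=> a u v; rewrite /qop -linearP /=; congr tpow.
rewrite !(linearP (@euler K M)) /= !linearP /= !scalerDr !scalerA !(mulrC a).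
by rewrite [RHS]addrACA; congr (_ + _); rewrite addrACA.
Qed.

HB.instance Definition _ n x y z :=
  GRing.isLinear.Build K M M *:%R (qop n x y z) (qop_linear n x y z).

Lemma HL_linear m : linear (HL m).
Proof. by move=> a u v; rewrite !HLE /= !qop_linear. Qed.
HB.instance Definition _ m :=
  GRing.isLinear.Build K (M * M)%type (M * M)%type *:%R (HL m) (HL_linear m).

Lemma HG_linear k : linear (HG k).
Proof. by move=> a u v; rewrite !HGE /= !qop_linear. Qed.
HB.instance Definition _ k :=
  GRing.isLinear.Build K (M * M)%type (M * M)%type *:%R (HG k) (HG_linear k).

Lemma HL_even m v : is_even v -> is_even (HL m v).
Proof. by rewrite /is_even HLE => /= ->; rewrite linear0. Qed.

Lemma HL_odd m v : is_odd v -> is_odd (HL m v).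
Proof. by rewrite /is_odd HLE => /= ->; rewrite linear0. Qed.

Lemma HG_even k v : is_even v -> is_odd (HG k v).
Proof. by rewrite /is_even /is_odd HGE => /= ->; rewrite linear0. Qed.

Lemma HG_odd k v : is_odd v -> is_even (HG k v).
Proof. by rewrite /is_even /is_odd HGE => /= ->; rewrite linear0. Qed.

Local Lemma pairD (x y x' y' : M) : (x, y) + (x', y') = (x + x', y + y').
Proof. by []. Qed.
Local Lemma pairN (x y : M) : - (x, y) = (- x, - y).
Proof. by []. Qed.
Local Lemma pairZ a (x y : M) : a *: (x, y) = (a *: x, a *: y).
Proof. by []. Qed.

Lemma HLL m n v : HL m (HL n v) - HL n (HL m v) = (m - n)%:~R *: HL (m + n) v.
Proof.
rewrite !HLE /= !qop_comp pairN pairD pairZ !(qopN, qopZ) (addrC n m) !qopD.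
rewrite !rmorphD !rmorphN /=.
by congr (qop _ _ _ _ _, qop _ _ _ _ _); field.
Qed.

Lemma HGG k l v : HG k (HG l v) + HG l (HG k v) = 2 *: HL (k + l + eps2 s) v.
Proof.
rewrite !HGE HLE /= !qop_comp pairD pairZ !(qopN, qopZ).
have -> : k + eps2 s + l = k + l + eps2 s by ring.
have -> : l + eps2 s + k = k + l + eps2 s by ring.
have -> : k + (l + eps2 s) = k + l + eps2 s by ring.
have -> : l + (k + eps2 s) = k + l + eps2 s by ring.
rewrite !qopD !rmorphD !rmorphN /=.
by congr (qop _ _ _ _ _, qop _ _ _ _ _); field.
Qed.

Lemma HLG m k v :
  HL m (HG k v) - HG k (HL m v) =
    (m%:~R / 2 - (k%:~R + eps K s)) *: HG (m + k) v.
Proof.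
rewrite !HGE !HLE /= !qop_comp pairN pairD pairZ !(qopN, qopZ) /eps.
have -> : k + eps2 s + m = m + k + eps2 s by ring.
have -> : m + (k + eps2 s) = m + k + eps2 s by ring.
rewrite (addrC k m) !qopD !rmorphD !rmorphN /=.
by congr (qop _ _ _ _ _, qop _ _ _ _ _); field.
Qed.

Definition Hmod : svir_module K s :=
  @SvirModule K s M M HL HG HL_even HL_odd HG_even HG_odd HLL HGG HLG.

End TensorModule.

(* Main.v *)
From HB Require Import structures.
Require Import Defs.
From mathcomp Require Import all_boot all_order all_algebra.
From mathcomp Require Import classical_sets reals complex.
From mathcomp Require Import boolp ring.

Import Order.TTheory GRing.Theory Num.Theory.
Local Open Scope ring_scope.

Set Implicit Arguments.
Unset Strict Implicit.
Unset Printing Implicit Defensive.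

(** Write e = 2 epsilon and D for the Euler operator. On pairs (x, y), with x
    in the even and y in the odd copy of M, the action of G is
      G_k (x, y) = (- t^(k+e) y, t^k (D + 2 k b) x),
    and the action of L is determined by that of G, since
    2 L_(k+l+e) = G_k G_l + G_l G_k. Isomorphisms are thus the homogeneous
    linear bijections commuting with all G_k.

    An even one is a pair (phi, psi). The relation phi t^(k+e) = t^(k+e) psi
    at k = - e gives phi = psi, which therefore commutes with all t^k; the
    other relation at k = 0 and k = 1 gives that psi commutes with D and that
    b1 = b2 ([Hmod_even_intertwiner]).

    An odd one has the form (x, y) |-> (psi y, phi x), with
      psi t^k (D + 2 k b1) = - t^(k+e) phi,
      - phi t^(k+e) = t^k (D + 2 k b2) psi.
    At k = 0 the first relation reads psi D = - t^e phi, and eliminating phi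
    yields, for all n,
      n (1 - 2 b1) psi t^n = 2 n b2 t^n psi.
    If b2 = 0, then n = 1 gives b1 = 1/2, and chi = psi D = - t^e phi is an
    isomorphism of Weyl modules; it is bijective, so D is onto on the source.
    If b2 <> 0, comparing n = 1 and n = 2 gives 1 - 2 b1 = 2 b2, so psi
    commutes with every t^n; then b1 = 0 and b2 = 1/2, and chi = t^(-e) psi is
    an isomorphism of Weyl modules. Now phi being bijective makes D onto on the
    target ([Hmod_odd_intertwiner]).

    Conversely (x, y) |-> (- t^e y, D x) intertwines b = 0 with b = 1/2, and is
    bijective as soon as D is ([svir_iso_Hmod_euler]). On an irreducible module
    D is injective when it is onto ([euler_surj_inj]): if D v = 0 with v
    nonzero, then the eigenvectors t^n v of D span the module, and v, of
    eigenvalue 0, is not in the image of D. *)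

(** * Linear algebra *)

Lemma scaler_injl (K : fieldType) (V : lmodType K) (v : V) (a b : K) :
  v <> 0 -> a *: v = b *: v -> a = b.
Proof.
move=> /eqP v0 /eqP; rewrite -subr_eq0 -scalerBl scaler_eq0 (negPf v0) orbF.
by rewrite subr_eq0 => /eqP.
Qed.

Lemma bij_neq0 (K : fieldType) (U V : lmodType K) (f : {linear U -> V}) u :
  bijective f -> u <> 0 -> f u <> 0.
Proof. by move=> /bij_inj fI u0 fu0; apply/u0/fI; rewrite fu0 linear0. Qed.

Lemma inv_is_linear (K : fieldType) (U V : lmodType K) (f : {linear U -> V})
    (g : V -> U) : cancel f g -> cancel g f -> linear g.
Proof. by move=> fK gK a u v; rewrite -{1}[u]gK -{1}[v]gK -linearP fK. Qed.

(** * Modules over the Weyl algebra *)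

Section WeylModule.
Variables (K : numFieldType) (M : dmodule K).
Implicit Types (v w : M) (n k : int).

Lemma tpowK n : cancel (@tpow K M n) (tpow (- n)).
Proof. by move=> v; rewrite tpowD addNr. Qed.

Lemma tpowNK n : cancel (@tpow K M (- n)) (tpow n).
Proof. by move=> v; rewrite tpowD addrN. Qed.

Lemma tpow_bij n : bijective (@tpow K M n).
Proof. exact: Bijective (@tpowK n) (@tpowNK n). Qed.

Lemma dd_euler v : dd v = tpow (-1) (euler v).
Proof. by rewrite /= /euler dtK. Qed.

Lemma euler_tpow_ker n v : euler v = 0 -> euler (tpow n v) = n%:~R *: tpow n v.
Proof. by move=> v0; rewrite euler_tpow v0 add0r linearZ. Qed.

(** [eulerB l] is the operator prod_(n <- l) (D - n), D the Euler operator. *)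
Definition eulerB (l : seq int) v : M :=
  foldr (fun n w => euler w - n%:~R *: w) v l.

Lemma eulerB_linear l : linear (eulerB l).
Proof.
elim: l => // n l IH a u v.
have step w : eulerB (n :: l) w = euler (eulerB l w) - n%:~R *: eulerB l w by [].
rewrite !step IH linearP /= scalerBr !scalerDr !scalerA.
by rewrite mulrC opprD addrACA.
Qed.
HB.instance Definition _ l :=
  GRing.isLinear.Build K M M *:%R (eulerB l) (eulerB_linear l).

Lemma eulerB_eigen l (a : K) v : euler v = a *: v ->
  eulerB l v = (\prod_(n <- l) (a - n%:~R)) *: v.
Proof.
move=> va; elim: l => [|n l IH] /=; first by rewrite big_nil scale1r.
by rewrite IH linearZ /= va big_cons !scalerA -scalerBl mulrBl (mulrC a).
Qed.

(** The span of the vectors t^n v. A list of pairs (n, a) encodes the linear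
    combination of the a t^n v; repeated exponents are allowed. *)
Definition tspan v : set M :=
  [set x | exists s : seq (int * K), x = \sum_(p <- s) p.2 *: tpow p.1 v]%classic.

Lemma tspan_submodule v : euler v = 0 -> dmod_submodule (tspan v).
Proof.
move=> v0; split.
- by exists [::]; rewrite big_nil.
- move=> a _ _ [s ->] [s' ->]; exists ([seq (p.1, a * p.2) | p <- s] ++ s').
  rewrite big_cat big_map scaler_sumr /=; congr (_ + _).
  by apply: eq_bigr => p _; rewrite scalerA.
have shift k (c : int -> K) s : exists s' : seq (int * K),
    \sum_(p <- s) (c p.1 * p.2) *: tpow k (tpow p.1 v)
    = \sum_(p <- s') p.2 *: tpow p.1 v.
  exists [seq (k + p.1, c p.1 * p.2) | p <- s].
  by rewrite big_map; apply: eq_bigr => p _; rewrite tpowD.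
have tE k s : exists s' : seq (int * K),
    tpow k (\sum_(p <- s) p.2 *: tpow p.1 v) = \sum_(p <- s') p.2 *: tpow p.1 v.
  have [s' e] := shift k (fun=> 1) s; exists s'; rewrite -e.
  by rewrite linear_sum; apply: eq_bigr => p _; rewrite linearZ /= mul1r.
move=> _ [s ->]; split; [exact: (tE 1) | exact: (tE (-1)) |].
have [s' e] := shift (-1) (fun n => n%:~R) s; exists s'; rewrite -e.
rewrite linear_sum; apply: eq_bigr => p _.
by rewrite linearZ_LR dd_euler euler_tpow_ker // linearZ scalerA mulrC.
Qed.

(** On an irreducible module where the Euler operator has a nonzero kernel, it is
    diagonalizable, so that its kernel meets its image in 0 only. *)
Lemma euler_surj_inj :
  dmod_irreducible M -> (forall v, exists w, euler w = v) ->
  injective (@euler K M).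
Proof.
move=> [_ irr] surj; apply: raddf_inj => v v0; apply/eqP/negPn/negP => /eqP nz.
have [w wv] := surj v.
have [S0|ST] := irr _ (tspan_submodule v0).
  have : tspan v v by exists [:: (0, 1)]; rewrite big_seq1 scale1r.
  by rewrite S0.
have [s ws] : tspan v w by rewrite ST.
(* D w has only terms t^n v with n a nonzero exponent of w, so the product
   of the D - n over those n kills v = D w; it also multiplies v by the
   nonzero product of the - n. *)
pose l := [seq n <- unzip1 s | n != 0].
have : eulerB l v = 0.
  have wE : euler w = \sum_(p <- s) (p.2 * p.1%:~R) *: tpow p.1 v.
    rewrite ws linear_sum; apply: eq_bigr => p _.
    by rewrite linearZ /= euler_tpow_ker // scalerA.
  rewrite -wv wE linear_sum big_seq big1 // => p ps.
  rewrite linearZ /= (eulerB_eigen _ (euler_tpow_ker _ v0)).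
  have [->|p0] := eqVneq p.1 0; first by rewrite mulr0 scale0r.
  have pl : p.1 \in l by rewrite mem_filter p0 map_f.
  by rewrite (big_rem _ pl) /= subrr mul0r scale0r scaler0.
rewrite (@eulerB_eigen _ 0) ?scale0r // => /eqP; rewrite scaler_eq0.
case/orP => [|/eqP //]; rewrite prodf_seq_eq0 => /hasP[n].
by rewrite mem_filter sub0r oppr_eq0 intr_eq0 => /andP[/negPf->].
Qed.

Lemma euler_surj_bij :
  dmod_irreducible M -> (forall v, exists w, euler w = v) ->
  bijective (@euler K M).
Proof.
move=> irr surj; have [g Kg] := choice surj; exists g => // v.
by apply: (euler_surj_inj irr surj); rewrite Kg.
Qed.

End WeylModule.

Lemma dmod_isoI (K : numFieldType) (M N : dmodule K) (f : {linear M -> N}) :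
    bijective f -> (forall n v, f (tpow n v) = tpow n (f v)) ->
    (forall v, f (euler v) = euler (f v)) ->
  dmod_iso M N.
Proof.
move=> fbij ft fD; exists f; split=> // v.
by split; [exact: (ft 1) | exact: (ft (-1)) | rewrite !dd_euler ft fD].
Qed.

Lemma dmod_iso_tpow (K : numFieldType) (M N : dmodule K) (f : {linear M -> N}) :
    (forall v, f (dt v) = dt (f v)) -> (forall v, f (dtV v) = dtV (f v)) ->
  forall n v, f (tpow n v) = tpow n (f v).
Proof.
move=> ft ftV [] k v; rewrite /tpow.
  by elim: k => //= k <-; rewrite ft.
by elim: k.+1 => //= j <-; rewrite ftV.
Qed.

(** * Isomorphisms of super-Virasoro modules *)

Section SvirIso.
Variables (K : numFieldType) (s : sector).
Implicit Types (U V W : svir_module K s).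

(** The operators G generate the algebra. *)
Lemma svG_comm_svL V W (f : {linear sv_car V -> sv_car W}) :
    (forall k v, f (svG V k v) = svG W k (f v)) ->
  forall m v, f (svL V m v) = svL W m (f v).
Proof.
move=> fG m v.
have two0 : (2 : K) != 0 by rewrite pnatr_eq0.
apply: (scalerI two0); rewrite -linearZ_LR.
have -> : m = (0 + (m - eps2 s)) + eps2 s by ring.
by rewrite -!svGG linearD !fG.
Qed.

Lemma svir_iso_trans U V W : svir_iso U V -> svir_iso V W -> svir_iso U W.
Proof.
move=> [f [fB fL fG fP]] [g [gB gL gG gP]]; exists (g \o f).
split=> [|m v|k v|] /=; [exact: bij_comp | by rewrite fL gL | by rewrite fG gG |].
case: fP gP => -[f0 f1] [] [g0 g1]; [left|right|right|left];
  by split=> v; auto.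
Qed.

Lemma svir_iso_sym V W : svir_iso V W -> svir_iso W V.
Proof.
move=> [f [[g fK gK] fL fG fP]].
have gl := inv_is_linear fK gK.
pose g' : {linear _ -> _} := HB.pack g (GRing.isLinear.Build _ _ _ _ g gl).
have fI := can_inj fK.
(* When w is homogeneous, so is g w: the component of g w of the wrong parity
   has an image under f which is both even and odd, hence 0. *)
have part (v : sv_car V) : exists v0 v1 : sv_car V,
    [/\ v = v0 + v1, is_even v0 & is_odd v1].
  case: v => x y; exists (x, 0), (0, y); split=> //.
  by congr (_, _); rewrite ?addr0 ?add0r.
have subE (w w' : sv_car W) : is_even w -> is_even w' -> is_even (w - w').
  by rewrite /is_even /= => -> ->; rewrite subr0.
have subO (w w' : sv_car W) : is_odd w -> is_odd w' -> is_odd (w - w').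
  by rewrite /is_odd /= => -> ->; rewrite subr0.
have disj (v : sv_car V) : is_even (f v) -> is_odd (f v) -> v = 0.
  move=> fv2 fv1; apply: fI; rewrite linear0; move: fv2 fv1.
  by case: (f v) => x y; rewrite /is_even /is_odd /= => -> ->.
have f1 (w : sv_car W) v0 v1 : g w = v0 + v1 -> f v1 = w - f v0.
  by move=> gw; rewrite -[w]gK gw linearD addrC addKr.
have f0 (w : sv_car W) v0 v1 : g w = v0 + v1 -> f v0 = w - f v1.
  by move=> gw; rewrite -[w]gK gw linearD addrK.
exists g'; split=> [|m v|k v|].
- exact: Bijective gK fK.
- by rewrite /= -[v in LHS]gK -fL fK.
- by rewrite /= -[v in LHS]gK -fG fK.
case: fP => -[fE fO]; [left|right]; split=> w hw /=;
  have [v0 [v1 [gw v0E v1O]]] := part (g w).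
- by rewrite gw (disj v1) ?addr0 //; [rewrite (f1 _ _ _ gw)|]; auto.
- by rewrite gw (disj v0) ?add0r //; [|rewrite (f0 _ _ _ gw)]; auto.
- by rewrite gw (disj v0) ?add0r //; [rewrite (f0 _ _ _ gw)|]; auto.
- by rewrite gw (disj v1) ?addr0 //; [|rewrite (f1 _ _ _ gw)]; auto.
Qed.
End SvirIso.

(** The parity change, as the exchange of the two components. *)
Definition pair_swap (K : fieldType) (A B : lmodType K) (v : A * B) : B * A :=
  (v.2, v.1).

Lemma pair_swap_linear (K : fieldType) (A B : lmodType K) :
  linear (@pair_swap K A B).
Proof. by []. Qed.
HB.instance Definition _ (K : fieldType) (A B : lmodType K) :=
  GRing.isLinear.Build K (A * B)%type (B * A)%type *:%R (@pair_swap K A B)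
    (@pair_swap_linear K A B).

Lemma even_components (K : numFieldType) (A0 A1 B0 B1 : lmodType K)
    (f : {linear (A0 * A1)%type -> (B0 * B1)%type}) :
    bijective f -> (forall v, is_even v -> is_even (f v)) ->
    (forall v, is_odd v -> is_odd (f v)) ->
  exists (phi : {linear A0 -> B0}) (psi : {linear A1 -> B1}),
    [/\ bijective phi, bijective psi & forall x y, f (x, y) = (phi x, psi y)].
Proof.
move=> [g fK gK] fE fO.
pose p x := (f (x, 0)).1; pose q y := (f (0, y)).2.
have pl : linear p.
  move=> a u v; rewrite /p -[RHS]/((a *: f (u, 0) + f (v, 0)).1) -linearP.
  by congr (f (_, _)).1; rewrite /= scaler0 addr0.
have ql : linear q.
  move=> a u v; rewrite /q -[RHS]/((a *: f (0, u) + f (0, v)).2) -linearP.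
  by congr (f (_, _)).2; rewrite /= scaler0 addr0.
pose phi : {linear _ -> _} := HB.pack p (GRing.isLinear.Build _ _ _ _ p pl).
pose psi : {linear _ -> _} := HB.pack q (GRing.isLinear.Build _ _ _ _ q ql).
have fpq x y : f (x, y) = (p x, q y).
  have -> : (x, y) = (x, 0) + (0, y) by congr (_, _); rewrite ?addr0 ?add0r.
  rewrite linearD [LHS]surjective_pairing /p /q; congr (_, _) => /=.
    by rewrite (fO (0, y) erefl) addr0.
  by rewrite (fE (x, 0) erefl) add0r.
have p0 : p 0 = 0 := linear0 phi.
have q0 : q 0 = 0 := linear0 psi.
exists phi, psi; split=> //.
  exists (fun z => (g (z, 0)).1) => [x|z] /=.
    by have := fpq x 0; rewrite q0 => <-; rewrite fK.
  have := gK (z, 0); rewrite [X in f X]surjective_pairing fpq.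
  by case.
exists (fun z => (g (0, z)).2) => [y|z] /=.
  by have := fpq 0 y; rewrite p0 => <-; rewrite fK.
by have := gK (0, z); rewrite [X in f X]surjective_pairing fpq; case.
Qed.

Lemma odd_components (K : numFieldType) (A0 A1 B0 B1 : lmodType K)
    (f : {linear (A0 * A1)%type -> (B0 * B1)%type}) :
    bijective f -> (forall v, is_even v -> is_odd (f v)) ->
    (forall v, is_odd v -> is_even (f v)) ->
  exists (phi : {linear A0 -> B1}) (psi : {linear A1 -> B0}),
    [/\ bijective phi, bijective psi & forall x y, f (x, y) = (psi y, phi x)].
Proof.
move=> fB fE fO.
have sB : bijective (@pair_swap K B0 B1) by exists (@pair_swap K B1 B0); case.
have [||phi [psi [phiB psiB fpq]]] := even_components (bij_comp sB fB).
- by move=> v /fE; rewrite /is_even /is_odd.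
- by move=> v /fO; rewrite /is_even /is_odd.
exists phi, psi; split=> // x y; have := fpq x y.
by rewrite /= /pair_swap; case: (f _) => u w /= [-> ->].
Qed.

(** * The modules H_(epsilon,b)(M) *)

Section TensorIso.
Variables (K : numFieldType) (s : sector).
Implicit Types (M N : dmodule K) (b : K).

Lemma svG_Hmod M b k (x y : M) :
  svG (Hmod M s b) k (x, y) =
    (- tpow (k + eps2 s) y, tpow k (euler x + (2 * k%:~R * b) *: x)).
Proof.
by rewrite /= HGE /qop /= !scale0r !add0r scale1r scaleN1r linearN.
Qed.

(** The two relations say that (phi, psi) commutes with the action of G; no
    irreducibility is needed, only a nonzero module. *)
Lemma Hmod_even_intertwiner M N b1 b2 (phi psi : {linear M -> N}) :
    (exists v : M, v <> 0) -> bijective psi ->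
    (forall k y, phi (tpow (k + eps2 s) y) = tpow (k + eps2 s) (psi y)) ->
    (forall k x, psi (tpow k (euler x + (2 * k%:~R * b1) *: x)) =
       tpow k (euler (phi x) + (2 * k%:~R * b2) *: phi x)) ->
  b1 = b2 /\ dmod_iso M N.
Proof.
move=> [v v0] psiB hphi hpsi.
have phiE x : phi x = psi x.
  by have := hphi (- eps2 s) x; rewrite addNr.
have psit n x : psi (tpow n x) = tpow n (psi x).
  by rewrite -phiE -[n](subrK (eps2 s)) hphi.
have psiD k x : psi (euler x) + (2 * k%:~R * b1) *: psi x =
    euler (psi x) + (2 * k%:~R * b2) *: psi x.
  have := hpsi k x; rewrite psit phiE => /(can_inj (@tpowK _ _ k)) <-.
  by rewrite linearD linearZ.
have psiD0 x : psi (euler x) = euler (psi x).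
  by have := psiD 0 x; rewrite !(mulr0, mul0r, scale0r, addr0).
split; last exact: dmod_isoI psiB psit psiD0.
have := psiD 1 v; rewrite psiD0 => /addrI/(scaler_injl (bij_neq0 psiB v0)).
by rewrite mulr1; apply: mulfI; rewrite pnatr_eq0.
Qed.

(** The two relations say that the odd map (x, y) |-> (psi y, phi x) commutes
    with the action of G. *)
Lemma Hmod_odd_intertwiner M N b1 b2 (phi psi : {linear M -> N}) :
    (exists v : M, v <> 0) -> bijective phi -> bijective psi ->
    (forall k x, psi (tpow k (euler x + (2 * k%:~R * b1) *: x)) =
       - tpow (k + eps2 s) (phi x)) ->
    (forall k y, - phi (tpow (k + eps2 s) y) =
       tpow k (euler (psi y) + (2 * k%:~R * b2) *: psi y)) ->
  [/\ b1 = 2^-1 /\ b2 = 0, dmod_iso M N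
    & forall w : M, exists v, euler v = w] \/
  [/\ b1 = 0 /\ b2 = 2^-1, dmod_iso M N
    & forall w : N, exists v, euler v = w].
Proof.
move=> [v v0] phiB psiB h1 h2.
have two0 : (2 : K) != 0 by rewrite pnatr_eq0.
have hD x : psi (euler x) = - tpow (eps2 s) (phi x).
  by have := h1 0 x; rewrite !(mulr0, mul0r, scale0r, addr0, add0r).
have hA k x : psi (tpow k (euler x)) + (2 * k%:~R * b1) *: psi (tpow k x) =
    tpow k (psi (euler x)).
  rewrite hD [RHS](linearN (@tpow K N k)) /= tpowD -h1 !linearD /=.
  by rewrite !linearZ.
have hB n x : psi (euler (tpow n x)) =
    tpow n (euler (psi x) + (2 * (n - eps2 s)%:~R * b2) *: psi x).
  rewrite hD -[n in LHS](subrK (eps2 s)).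
  rewrite -(linearN (@tpow K N (eps2 s))) /= h2 tpowD.
  by rewrite addrC subrK.
have hB0 x : psi (euler x) = euler (psi x) - (2 * (eps2 s)%:~R * b2) *: psi x.
  by rewrite -[x in LHS]/(tpow 0 x) hB sub0r rmorphN /= mulrN mulNr scaleNr.
(* As D t^n = t^n (D + n), both [hA] and [hB] compute psi t^n D. *)
have hC n x : (n%:~R * (1 - 2 * b1)) *: psi (tpow n x) =
    (2 * n%:~R * b2) *: tpow n (psi x).
  have := hB n x; rewrite euler_tpow !linearD /= !linearZ /=.
  have -> : psi (tpow n (euler x)) =
      tpow n (psi (euler x)) - (2 * n%:~R * b1) *: psi (tpow n x).
    by rewrite -hA addrK.
  rewrite hB0 linearB /= linearZ /= -!addrA => /addrI.
  set P := psi (tpow n x); set T := tpow n (psi x) => e.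
  have -> : (n%:~R * (1 - 2 * b1)) *: P = (2 * (eps2 s)%:~R * b2) *: T
      + (- ((2 * (eps2 s)%:~R * b2) *: T)
         + (- ((2 * n%:~R * b1) *: P) + n%:~R *: P)).
    rewrite addNKr -scaleNr -scalerDl; congr (_ *: _); ring.
  rewrite e -scalerDl; congr (_ *: _); rewrite rmorphB /=; ring.
have psiv0 : psi v <> 0 := bij_neq0 psiB v0.
have tpsiv0 n : tpow n (psi v) <> 0 := bij_neq0 (@tpow_bij K N n) psiv0.
have psitv0 n : psi (tpow n v) <> 0.
  exact: bij_neq0 psiB (bij_neq0 (@tpow_bij K M n) v0).
have [b20|b2n0] := eqVneq b2 0.
  left.
  have b1E : 2 * b1 = 1.
    have := hC 1 v; rewrite b20 mulr0 scale0r mul1r -[RHS](scale0r (psi (tpow 1 v))).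
    by move/(scaler_injl (psitv0 1))/eqP; rewrite subr_eq0 eq_sym => /eqP.
  have b1V : b1 = 2^-1 by apply: (mulfI two0); rewrite b1E mulfV.
  have psiD x : psi (euler x) = euler (psi x).
    by rewrite hB0 b20 mulr0 scale0r subr0.
  pose chi : {linear M -> N} := psi \o @euler K M.
  have chiE x : chi x = tpow (eps2 s) (- phi x) by rewrite linearN /= hD.
  have chiB : bijective chi.
    have nB : bijective (fun x => - phi x).
      by apply: (bij_comp _ phiB); exists -%R; exact: opprK.
    have B := bij_comp (@tpow_bij K N (eps2 s)) nB.
    by apply: (eq_bij B) => x; rewrite chiE.
  split=> //.
    apply: dmod_isoI chiB _ _ => [n x|x] /=; last by rewrite psiD.
    by rewrite hB b20 mulr0 scale0r addr0 psiD.
  move=> w; have [g gK Kg] := chiB; exists (g (psi w)).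
  by apply: (bij_inj psiB); exact: Kg.
right.
(* With r = (1 - 2 b1) / (2 b2), the cases n = 1 and n = 2 of [hC] are
   t psi = r psi t and t^2 psi = r psi t^2, while the first gives
   t^2 psi = r^2 psi t^2; as r <> 0, this forces r = 1. *)
have c : 1 - 2 * b1 = 2 * b2.
  have h x : (1 - 2 * b1) *: psi (dt x) = (2 * b2) *: dt (psi x).
    by have := hC 1 x; rewrite mul1r mulr1.
  have h2' : (1 - 2 * b1) *: psi (dt (dt v)) = (2 * b2) *: dt (dt (psi v)).
    by apply: (scalerI two0); rewrite !scalerA [2 * (2 * b2)]mulrA; exact: (hC 2 v).
  apply: (mulIf (mulf_neq0 two0 b2n0)); apply: (scaler_injl (tpsiv0 2)).
  move: (1 - 2 * b1) (2 * b2) h h2' => a c h h2'.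
  have hh : a *: (a *: psi (dt (dt v))) = c *: (c *: dt (dt (psi v))).
    have e : c *: dt (dt (psi v)) = a *: dt (psi (dt v)).
      by rewrite -!(linearZ_LR (@dt K N)) h !(linearZ_LR (@dt K N)).
    by rewrite h e !scalerA mulrC.
  by rewrite -!scalerA -hh h2'.
have psit n x : psi (tpow n x) = tpow n (psi x).
  have [->//|n0] := eqVneq n 0.
  have nz : n%:~R * (2 * b2) != 0 by rewrite !mulf_neq0 ?intr_eq0.
  by apply: (scalerI nz); rewrite -{1}c hC; congr (_ *: _); ring.
have b10 : b1 = 0.
  have := hA 1 v; rewrite psit -[RHS]addr0 => /addrI.
  rewrite -[RHS](scale0r (psi (tpow 1 v))) => /(scaler_injl (psitv0 1)).
  by move/eqP; rewrite mulr1 mulf_eq0 (negPf two0) => /eqP.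
have b2E : 2 * b2 = 1 by rewrite -c b10 mulr0 subr0.
have b2V : b2 = 2^-1 by apply: (mulfI two0); rewrite b2E mulfV.
pose chi : {linear M -> N} := @tpow K N (- eps2 s) \o psi.
have chiB : bijective chi := bij_comp (@tpow_bij K N _) psiB.
have chiD x : chi (euler x) = euler (chi x).
  rewrite /= euler_tpow hB0 mulrAC b2E mul1r.
  by rewrite rmorphN scaleNr.
split=> //.
  apply: dmod_isoI chiB _ chiD => n x.
  by rewrite /= psit !tpowD addrC.
move=> w; have [g gK Kg] := phiB.
exists (chi (g (- w))); rewrite -chiD /= hD Kg (linearN (@tpow K N (eps2 s))) /= opprK.
exact: tpowK.
Qed.

(** The constraints on an isomorphism, for arbitrary nonzero Weyl modules. *)
Lemma Hmod_iso_inv M N b1 b2 :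
    (exists v : M, v <> 0) -> svir_iso (Hmod M s b1) (Hmod N s b2) ->
  [\/ b1 = b2 /\ dmod_iso M N,
      [/\ b1 = 2^-1 /\ b2 = 0, dmod_iso M N
        & forall w : M, exists v, euler v = w]
    | [/\ b1 = 0 /\ b2 = 2^-1, dmod_iso M N
        & forall w : N, exists v, euler v = w]].
Proof.
move=> nz [f [fB _ fG [[fE fO]|[fE fO]]]].
  have [phi [psi [phiB psiB fpq]]] := even_components fB fE fO.
  constructor 1; apply: (Hmod_even_intertwiner nz psiB (phi := phi)) => k x.
    have := fG k (0, x); rewrite svG_Hmod !fpq svG_Hmod => -[+ _].
    by rewrite linearN => /oppr_inj.
  by have := fG k (x, 0); rewrite svG_Hmod !fpq svG_Hmod => -[_].
have [phi [psi [phiB psiB fpq]]] := odd_components fB fE fO.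
suff [] : [/\ b1 = 2^-1 /\ b2 = 0, dmod_iso M N
    & forall w : M, exists v, euler v = w] \/
  [/\ b1 = 0 /\ b2 = 2^-1, dmod_iso M N
    & forall w : N, exists v, euler v = w] by [constructor 2|constructor 3].
apply: (Hmod_odd_intertwiner nz phiB psiB) => k x.
  by have := fG k (x, 0); rewrite svG_Hmod !fpq svG_Hmod => -[].
have := fG k (0, x); rewrite svG_Hmod !fpq svG_Hmod => -[_].
by rewrite linearN.
Qed.

Lemma svir_iso_Hmod M N b :
  dmod_iso M N -> svir_iso (Hmod M s b) (Hmod N s b).
Proof.
move=> [f [[g fK gK] fE]].
have ft := dmod_iso_tpow (fun v => let: And3 h _ _ := fE v in h)
                         (fun v => let: And3 _ h _ := fE v in h).
have fD v : f (euler v) = euler (f v).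
  by rewrite /euler; have [-> _ _] := fE (dd v); have [_ _ ->] := fE v.
pose F (v : M * M) : N * N := (f v.1, f v.2).
have Fl : linear F by move=> a u v; rewrite /F !linearP.
pose F' : {linear sv_car (Hmod M s b) -> sv_car (Hmod N s b)} :=
  HB.pack F (GRing.isLinear.Build _ _ _ _ F Fl).
have FG k v : F' (svG (Hmod M s b) k v) = svG (Hmod N s b) k (F' v).
  case: v => x y; rewrite -[F' (x, y)]/(f x, f y) !svG_Hmod.
  rewrite -[LHS]/(f _, f _); congr (_, _); first by rewrite linearN ft.
  by rewrite ft linearD fD linearZ.
exists F'; split=> //; last 1 first.
- left; split=> -[x y]; rewrite /is_even /is_odd /= => ->; exact: linear0.
- by exists (fun v => (g v.1, g v.2)) => -[x y]; rewrite /= /F /= ?fK ?gK.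
- exact: svG_comm_svL.
Qed.

(** The exceptional isomorphism (x, y) |-> (- t^e y, D x), which is odd. *)
Lemma svir_iso_Hmod_euler M : bijective (@euler K M) ->
  svir_iso (Hmod M s 0) (Hmod M s 2^-1).
Proof.
move=> [g gK Kg].
have two0 : (2 : K) != 0 by rewrite pnatr_eq0.
pose F (v : M * M) : M * M := (- tpow (eps2 s) v.2, euler v.1).
have Fl : linear F.
  move=> a u v; rewrite [RHS]surjective_pairing /F /=.
  by rewrite (linearP (@tpow K M _)) (linearP (@euler K M)) opprD scalerN.
pose F' : {linear sv_car (Hmod M s 0) -> sv_car (Hmod M s 2^-1)} :=
  HB.pack F (GRing.isLinear.Build _ _ _ _ F Fl).
have FG k v : F' (svG (Hmod M s 0) k v) = svG (Hmod M s 2^-1) k (F' v).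
  case: v => x y; rewrite -[F' (x, y)]/(- tpow (eps2 s) y, euler x) !svG_Hmod.
  rewrite -[LHS]/(- tpow (eps2 s) _, euler _) mulr0 scale0r addr0.
  congr (_, _); first by rewrite tpowD addrC.
  rewrite -tpowD !(linearN (@euler K M)) /= mulrAC mulfV // mul1r scalerN -opprD.
  by rewrite (linearN (@tpow K M k)) /= euler_tpow.
exists F'; split=> //; last 1 first.
- right; split=> -[x y]; rewrite /is_even /is_odd /F' /F /= => ->.
    by rewrite linear0 oppr0.
  exact: linear0.
- exists (fun v => (g v.2, - tpow (- eps2 s) v.1)) => -[x y]; rewrite /= /F /=.
    by rewrite gK (linearN (@tpow K M _)) /= opprK tpowK.
  by rewrite Kg (linearN (@tpow K M _)) /= opprK tpowNK.
- exact: svG_comm_svL.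
Qed.

End TensorIso.

Theorem theorem4p8 (R : realType) (s : sector) (b1 b2 : R[i])
    (M1 M2 : dmodule R[i])
    (irr1 : dmod_irreducible M1) (irr2 : dmod_irreducible M2) :
  svir_iso (Hmod M1 s b1) (Hmod M2 s b2) <->
  [\/ b1 = b2 /\ dmod_iso M1 M2,
      [/\ b1 = 2^-1 /\ b2 = 0, dmod_iso M1 M2
        & range (@euler R[i] M1) = [set: M1]%classic]
    | [/\ b1 = 0 /\ b2 = 2^-1, dmod_iso M1 M2
        & range (@euler R[i] M2) = [set: M2]%classic]].
Proof.
have rangeP (M : dmodule R[i]) : (forall w : M, exists v, euler v = w) <->
    range (@euler R[i] M) = [set: M]%classic.
  split=> [surj|rE w]; last first.
    have : range (@euler R[i] M) w by rewrite rE.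
    by case=> v _ <-; exists v.
  by rewrite eqEsubset; split=> // w _; have [v <-] := surj w; exists v.
split=> [iso|].
  have [//|[b12 iso12 surj]|[b12 iso12 surj]] := Hmod_iso_inv irr1.1 iso.
  - by constructor 1.
  - by constructor 2; split=> //; apply/rangeP.
  - by constructor 3; split=> //; apply/rangeP.
case=> [[-> iso]|[[-> ->] iso rE]|[[-> ->] iso rE]].
- exact: svir_iso_Hmod.
- apply: svir_iso_trans (svir_iso_Hmod s 0 iso).
  exact/svir_iso_sym/svir_iso_Hmod_euler/euler_surj_bij/rangeP.
- apply: svir_iso_trans (svir_iso_Hmod s 0 iso) _.
  exact/svir_iso_Hmod_euler/euler_surj_bij/rangeP.
Qed.
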